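(* Let $n\ge2$ be an integer, let $c\in\mathbb{C}$ with $c\neq 0$, let $f_c(z)=z^n+c$, and put $\widehat c=c^{n-1}$. If the orbit of the critical point $0$ under $f_c$ is eventually periodic, then $c$ and $\widehat c$ are algebraic integers, with $\mathrm{Norm}(\widehat c)$ dividing $n$. In the special case where the critical point is actually periodic with period $>1$, this can be sharpened to say that $\mathrm{Norm}(\widehat c)=\pm1$.
   Context: For an algebraic number $x$ of degree $d$ over $\mathbb{Q}$, $\mathrm{Norm}(x)\in\mathbb{Q}$ is the product of the $d$ algebraic conjugates of $x$ over $\mathbb{Q}$ (i.e. the norm from $\mathbb{Q}(x)$ to $\mathbb{Q}$); it is an integer if $x$ is an algebraic integer. The orbit of a point is eventually periodic if some forward iterate of the point is periodic (this includes the case where the point itself is periodic). *)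

(* Defs.v *)
From mathcomp Require Import all_boot all_order all_algebra.
From mathcomp Require Import complex boolp classical_sets reals.

Set Implicit Arguments.
Unset Strict Implicit.
Unset Printing Implicit Defensive.

Import Order.TTheory GRing.Theory Num.Theory.
Local Open Scope ring_scope.

Section Dynamics.
Variables (T : Type) (f : T -> T).

(* The period is the least one. *)
Definition has_period (z : T) (p : nat) : Prop :=
  [/\ (0 < p)%N, iter p f z = z
    & forall k : nat, (0 < k < p)%N -> iter k f z <> z].

Definition periodic (z : T) : Prop :=
  exists2 p : nat, (0 < p)%N & iter p f z = z.

Definition eventually_periodic (z : T) : Prop :=
  exists k : nat, periodic (iter k f z).

End Dynamics.

Definition unicritical (K : nzRingType) (n : nat) (c z : K) : K := z ^+ n + c.

Section AlgebraicNumbers.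
Variable K : numClosedFieldType.

Definition algebraic_integer (x : K) : Prop := integralOver (intr : int -> K) x.

Definition is_rat_minpoly (x : K) (p : {poly rat}) : Prop :=
  [/\ p \is monic, irreducible_poly p & root (map_poly ratr p) x].

(* The default value 1 is only taken when x is transcendental over rat. *)
Definition rat_minpoly (x : K) : {poly rat} :=
  xget 1 [set p | is_rat_minpoly x p]%classic.

(* The roots in K of the minimal polynomial; they are pairwise distinct and
   their number is the degree of x, irreducible polynomials being separable in
   characteristic 0. *)
Definition conjugates (x : K) : seq K :=
  sval (closed_field_poly_normal (map_poly ratr (rat_minpoly x) : {poly K})).

Definition alg_norm (x : K) : K := \prod_(y <- conjugates x) y.

End AlgebraicNumbers.

(* Main.v *)
(* Dividing the critical orbit of [z ^+ n + c] by [c] gives polynomials with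
   integer coefficients in [chat], which are monic and have constant term 1.
   If 0 is periodic, one of them vanishes at [chat]. If 0 is only eventually
   periodic, dividing [x ^+ n = y ^+ n] by [x - y] at the first collision of
   the orbit gives a monic polynomial vanishing at [chat] with constant term
   [n]. By Gauss' lemma the minimal polynomial of [chat] divides such a
   polynomial over the integers, and its constant term is the norm up to sign. *)
Require Import Defs.
From mathcomp Require Import all_boot all_order all_algebra.
From mathcomp Require Import complex reals.
From mathcomp Require Import boolp classical_sets algebraics_fundamentals.
From mathcomp Require Import zify.

Import Order.TTheory GRing.Theory Num.Theory.
Local Open Scope ring_scope.

Section MinimalPolynomial.
Variables (K : numClosedFieldType) (x : K).

Lemma rat_minpolyP :
  integralOver (ratr : rat -> K) x -> is_rat_minpoly x (rat_minpoly x).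
Proof.
move=> x_int; rewrite /rat_minpoly.
(* Whether an element of [K] is rational is decided classically; this yields a minimal polynomial,
   so [xget] does not fall back on its default. *)
have dec : decidable_embedding (ratr : {rmorphism rat -> K}).
  by move=> y; apply: pselect.
have [p [p_monic px p_irr]] := minPoly_decidable_closure dec x_int.
by apply: (xgetPex 1); exists p.
Qed.

(** Otherwise irreducibility makes the two polynomials coprime, and a Bezout relation evaluated at
    [x] reads 0 = 1. *)
Lemma rat_minpoly_dvd (q : {poly rat}) :
  q \is monic -> root (map_poly ratr q) x -> rat_minpoly x %| q.
Proof.
move=> q_monic qx.
have [_ pI px] := rat_minpolyP (ex_intro2 _ _ q q_monic qx).
rewrite -[_ %| _]negbK -irreducible_poly_coprime //.
apply/negP => /Bezout_eq1_coprimepP[[u v] /= uv1].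
have /eqP : (map_poly ratr (u * rat_minpoly x + v * q)).[x] = 0 :> K.
  by rewrite rmorphD !rmorphM hornerD !hornerM (eqP px) (eqP qx) !mulr0 addr0.
by rewrite uv1 rmorph1 hornerC oner_eq0.
Qed.

(** Vieta's formula, read off the splitting of the monic minimal polynomial into linear factors. *)
Lemma alg_normE :
  integralOver (ratr : rat -> K) x ->
  alg_norm x = (-1) ^+ size (conjugates x) * ratr (rat_minpoly x)`_0.
Proof.
move=> /rat_minpolyP[p_monic _ _].
rewrite /alg_norm /conjugates; case: closed_field_poly_normal => s /= sE.
rewrite -coef_map sE lead_coef_map (eqP p_monic) rmorph1 scale1r.
by rewrite coef0_prod_XsubC mulrA -exprD addnn -signr_odd odd_double mul1r.
Qed.

Lemma alg_norm_dvd (q : {poly int}) :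
  q \is monic -> root (map_poly intr q) x ->
  exists2 m : int, alg_norm x = m%:~R & (m %| q`_0)%Z.
Proof.
move=> q_monic qx; pose qQ := map_poly (intr : int -> rat) q.
have qQ_monic : qQ \is monic by apply: monic_map.
have qQx : root (map_poly ratr qQ) x.
  rewrite -map_poly_comp (eq_map_poly (g := intr)) // => a /=.
  by rewrite ratr_int.
have x_int : integralOver (ratr : rat -> K) x by exists qQ.
have [p_monic _ _] := rat_minpolyP x_int.
have [p1 [a a0 pE] [r qE]] := dvdpP_rat_int (rat_minpoly_dvd _ qQ_monic qQx).
(* Since [q = p1 * r] is monic, both leading coefficients are units of [int]; hence the rational
   scalar [a] equals [lead_coef r], a sign. *)
have lp1 : lead_coef r * lead_coef p1 = 1.
  by rewrite mulrC -lead_coefM -qE (eqP q_monic).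
have al : a * (lead_coef p1)%:~R = 1.
  rewrite -[RHS](eqP p_monic) pE lead_coefZ.
  by rewrite (lead_coef_map_inj (@intr_inj rat)).
have aE : a = (lead_coef r)%:~R.
  transitivity (a * (lead_coef r * lead_coef p1)%:~R).
    by rewrite lp1 mulr1.
  by rewrite intrM mulrCA al mulr1.
exists ((-1) ^+ size (conjugates x) * (lead_coef r * p1`_0)).
  rewrite (alg_normE x_int) pE aE coefZ coef_map /= -intrM ratr_int.
  by rewrite [in RHS]intrM rmorphXn /= rmorphN1.
have lr1 : `|lead_coef r|%N = 1%N.
  apply/eqP; rewrite -dvdz1; apply/dvdzP; exists (lead_coef p1).
  by rewrite mulrC lp1.
by rewrite qE coef0M dvdzE !abszM abszX exp1n lr1 !mul1n dvdn_mulr.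
Qed.

End MinimalPolynomial.

(** Integrality is transitive, and [x] is a root of a monic polynomial with integral
    coefficients. *)
Lemma algebraic_integer_exp (K : numClosedFieldType) (x : K) k :
  (0 < k)%N -> algebraic_integer (x ^+ k) -> algebraic_integer x.
Proof.
move=> k_gt0 xk_int.
apply: (integral_root_monic (p := 'X^k - (x ^+ k)%:P)).
- exact: monicXnsubC.
- by rewrite rootE !hornerE subrr.
- apply/integral_poly => i; rewrite coefB coefXn coefC.
  apply: integral_sub; first exact: integral_nat.
  by case: ifP => _ //; apply: integral0.
Qed.

Section GeometricSum.
Variable R : idomainType.
Implicit Types p q : {poly R}.

Lemma size_monic_exp p k : p \is monic -> size (p ^+ k) = ((size p).-1 * k).+1.
Proof.
move=> p_monic; rewrite -size_exp prednK // lt0n size_poly_eq0.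
exact/monic_neq0/monic_exp.
Qed.

(** The term [i = 0] is a power of [p] and dominates: every other term trades factors [p] for
    factors [q] of smaller degree. *)
Lemma monic_geom_sum p q n : (0 < n)%N ->
  p \is monic -> q \is monic -> (size q < size p)%N ->
  \sum_(i < n) p ^+ (n.-1 - i) * q ^+ i \is monic.
Proof.
case: n => // n _ p_monic q_monic lt_qp.
rewrite big_ord_recl /= subn0 mulr1 monicE lead_coefDl.
  by rewrite -monicE monic_exp.
rewrite size_monic_exp // ltnS (leq_trans (size_sum _ _ _)) //.
apply/bigmax_leqP => i _; rewrite /bump leq0n add1n.
rewrite size_monicM ?monic_exp ?monic_neq0 ?monic_exp // !size_monic_exp //.
have := ltn_ord i.
have q_gt0 : (0 < size q)%N by rewrite lt0n size_poly_eq0 monic_neq0.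
move: lt_qp q_gt0; case: (size p) (size q) => [|a] [|b] //= lt_ba _ lt_in.
nia.
Qed.

End GeometricSum.

Section CriticalOrbit.

(* The critical orbit of [z ^+ n + c] is [c * (crit_poly n k).[c ^+ n.-1]]. *)
Definition crit_poly (n k : nat) : {poly int} :=
  iter k (fun p => 'X * p ^+ n + 1) 0.

Variables (n : nat).
Hypothesis n_gt1 : (1 < n)%N.
Local Notation P := (crit_poly n).

Lemma crit_polyS k : P k.+1 = 'X * P k ^+ n + 1.
Proof. by []. Qed.

(** From [P 1 = 1] on, the recursion sends degree [d] to [d * n + 1]. Monicity starts at [k.+1]
    because [P 0 = 0]. *)
Lemma crit_poly_monic k : P k.+1 \is monic /\ (size (P k) < size (P k.+1))%N.
Proof.
elim: k => [|k [P_monic lt_P]].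
  rewrite crit_polyS /= expr0n gtn_eqF ?(ltnW n_gt1) // mulr0 add0r.
  by rewrite monic1 size_poly1 size_poly0.
have sXP : size ('X * P k.+1 ^+ n) = ((size (P k.+1)).-1 * n).+2.
  rewrite size_monicM ?monicX ?monic_neq0 ?monic_exp //.
  by rewrite size_polyX size_monic_exp.
have lt1 : (size (1%R : {poly int}) < size ('X * P k.+1 ^+ n)%R)%N.
  by rewrite size_poly1 sXP.
rewrite (crit_polyS k.+1); split.
  by rewrite monicE lead_coefDl // lead_coef_Mmonic ?monic_exp // lead_coefX.
by rewrite (size_polyDl lt1) sXP; case: (size _) n_gt1 => [|a] /=; nia.
Qed.

Lemma crit_poly_lt_size j k : (j < k)%N -> (size (P j) < size (P k))%N.
Proof.
move: j k; apply: (homo_ltn ltn_trans) => k.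
by have [] := crit_poly_monic k.
Qed.

Lemma crit_poly_coef0 k : (P k.+1)`_0 = 1.
Proof. by rewrite crit_polyS coefD coefXM coef1 add0r. Qed.

(** A factor [c] comes out at each iteration because [c ^+ n = c * c ^+ n.-1]. *)
Lemma crit_polyE (R : comNzRingType) (c : R) k :
  iter k (unicritical n c) 0 = c * (map_poly intr (P k)).[c ^+ n.-1].
Proof.
elim: k => [|k IHk]; first by rewrite /= rmorph0 horner0 mulr0.
rewrite crit_polyS iterS IHk /unicritical.
rewrite rmorphD rmorphM rmorphXn rmorph1 /= map_polyX.
rewrite !hornerE mulrDr mulr1 mulrA -exprS prednK ?(ltnW n_gt1) //.
by rewrite exprMn.
Qed.

Variables (R : idomainType) (z : R).
Local Notation u k := (map_poly intr (P k)).[z].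

(* At the first collision [x ^+ n = y ^+ n] with [x != y], the witness is
   [\sum_i x ^+ (n.-1 - i) * y ^+ i], whose constant term is [n] because all
   the [P k.+1] are [1] modulo ['X]. *)
Lemma postcritical_poly k p : z != 0 -> (0 < p)%N -> u (p + k) = u k ->
  exists q : {poly int},
    [/\ q \is monic, root (map_poly intr q) z & (q`_0 %| n%:Z)%Z].
Proof.
move=> z0 p_gt0; elim: k => [|k IHk].
  (* The orbit returns to its start, so [P p] itself vanishes at [z], with constant term 1. *)
  rewrite addn0 rmorph0 horner0; case: p p_gt0 => // p _ /eqP Pz.
  exists (P p.+1); rewrite crit_poly_coef0 dvd1z.
  by have [] := crit_poly_monic p.
rewrite addnS; pose x := u (p + k)%N; pose y := u k.
have uS j : u j.+1 = z * u j ^+ n + 1.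
  by rewrite crit_polyS rmorphD rmorphM rmorphXn rmorph1 /= map_polyX !hornerE.
rewrite !uS => /addIr /(mulfI z0) xyn.
(* If [x = y], the collision already occurs one step earlier. *)
have [|neq_xy] := eqVneq x y; first exact: IHk.
(* For [k = 0] one has [y = 0], so [x ^+ n = 0] forces [x = y], a contradiction. *)
case: k => [|k] in x y xyn neq_xy IHk *.
  move: xyn neq_xy; rewrite -/x -/y.
  have -> : y = 0 by rewrite /y rmorph0 horner0.
  rewrite expr0n gtn_eqF ?(ltnW n_gt1) // => /eqP.
  by rewrite expf_eq0 => /andP[_ ->].
have pE : (p + k.+1 = (p + k).+1)%N by rewrite addnS.
exists (\sum_(i < n) P (p + k.+1) ^+ (n.-1 - i) * P k.+1 ^+ i); split.
- apply: monic_geom_sum; rewrite ?(ltnW n_gt1) //.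
  + by rewrite pE; have [] := crit_poly_monic (p + k).
  + by have [] := crit_poly_monic k.
  + by apply: crit_poly_lt_size; rewrite -{1}[k.+1]add0n ltn_add2r.
- rewrite rootE rmorph_sum horner_sum.
  have /eqP : (x - y) * \sum_(i < n) x ^+ (n.-1 - i) * y ^+ i = 0.
    by rewrite -subrXX /x /y xyn subrr.
  rewrite mulf_eq0 subr_eq0 (negbTE neq_xy) /= => /eqP {2}<-; apply/eqP.
  by apply: eq_bigr => i _; rewrite rmorphM !rmorphXn hornerM !horner_exp.
- rewrite -horner_coef0 horner_sum.
  under eq_bigr => i _ do
    rewrite hornerM !horner_exp !horner_coef0 pE !crit_poly_coef0 !expr1n mulr1.
  by rewrite sumr_const card_ord natz dvdzz.
Qed.

End CriticalOrbit.

Theorem theorem3p2 (R : realType) (n : nat) (c : R[i])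
    (hn : (2 <= n)%N) (hc : c != 0) :
  let chat : R[i] := c ^+ n.-1 in
  (eventually_periodic (unicritical n c) 0 ->
     [/\ algebraic_integer c, algebraic_integer chat
       & exists2 m : int, alg_norm chat = m%:~R & (m %| n%:Z)%Z])
  /\
  (forall p : nat, (1 < p)%N -> has_period (unicritical n c) 0 p ->
     alg_norm chat = 1 \/ alg_norm chat = -1).
Proof.
move=> chat; split=> [[k [p p_gt0]]|[//|p] p_gt1 [_ + _]].
  (* Cancelling [c] turns the collision in the orbit into one between values of the [crit_poly] at
     [chat]. *)
  rewrite -iterD !crit_polyE // => /(mulfI hc) /postcritical_poly[] //.
    by rewrite expf_neq0.
  move=> q [q_monic qx q0]; have chat_int : algebraic_integer chat by exists q.
  split=> //.
    by apply: (@algebraic_integer_exp _ _ n.-1); rewrite // -subn1 subn_gt0.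
  have [m normE m_q] := alg_norm_dvd _ _ _ q_monic qx.
  by exists m => //; apply: dvdz_trans q0.
rewrite crit_polyE // => /eqP; rewrite mulf_eq0 (negbTE hc) /= => Pz.
have [P_monic _] := crit_poly_monic _ hn p.
have [m ->] := alg_norm_dvd _ _ _ P_monic Pz.
rewrite crit_poly_coef0 dvdz1 => /eqP m1.
have [->|->] : m = 1 \/ m = -1 by lia.
  by left.
by right; rewrite rmorphN1.
Qed.
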